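(* Let $k$ be a non-negative integer and let $G$ be a connected $K_{1,4}$-free graph of order $n$. If $\sigma_{k+3}(G) \ge n-k$, then $G$ has a spanning tree $T$ with $|L(T)|+|B(T)| \le 2k+3$. (In particular, such a $T$ has at most $k$ branch vertices.)
   Context: All graphs are finite and simple. For a tree $T$, a leaf is a vertex of degree one in $T$ and a branch vertex is a vertex of degree at least three in $T$; $L(T)$ and $B(T)$ denote the sets of leaves and of branch vertices of $T$. A graph is $K_{1,4}$-free if it contains no induced subgraph isomorphic to $K_{1,4}$. For a positive integer $p$, $\sigma_p(G)=+\infty$ if the independence number of $G$ is less than $p$, and otherwise $\sigma_p(G)$ is the minimum of $\sum_{i=1}^p d_G(v_i)$ over all independent sets $\{v_1,\dots,v_p\}$ of $G$ of size $p$. *)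

(* Defs.v *)
From mathcomp Require Import all_boot.
Set Implicit Arguments. Unset Strict Implicit. Unset Printing Implicit Defensive.

Section Graphs.
Variable T : finType.

Definition simple_graph (e : rel T) : Prop := symmetric e /\ irreflexive e.

Definition connected (e : rel T) : Prop := forall x y : T, connect e x y.

Definition deg (e : rel T) (x : T) : nat := #|[set y | e x y]|.

Definition independent (e : rel T) (S : {set T}) : bool :=
  [forall x in S, forall y in S, ~~ e x y].

Definition K14_free (e : rel T) : Prop :=
  ~ exists (c : T) (S : {set T}),
      [/\ #|S| = 4, independent e S & {in S, forall y, e c y}].

(* sigma_p(G) >= m : every independent set of size p has degree sum >= m
   (vacuous when the independence number is < p, i.e. sigma_p = +oo). *)
Definition sigma_ge (e : rel T) (p m : nat) : Prop :=
  forall S : {set T}, independent e S -> #|S| = p ->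
    m <= \sum_(v in S) deg e v.

Definition has_cycle (t : rel T) : Prop :=
  exists (x : T) (p : seq T),
    [/\ 2 <= size p, uniq (x :: p), path t x p & t (last x p) x].

Definition is_tree (t : rel T) : Prop :=
  simple_graph t /\ connected t /\ ~ has_cycle t.

(* t is a spanning tree of the graph e (its vertex set is all of T) *)
Definition spanning_tree (e t : rel T) : Prop :=
  is_tree t /\ subrel t e.

Definition leaves (t : rel T) : {set T} := [set x | deg t x == 1].
Definition branch_vertices (t : rel T) : {set T} := [set x | 3 <= deg t x].

End Graphs.

(* Main.v *)
(* Let T be a spanning tree with as few leaves as possible and, among those, as few branch
   vertices as possible.  It suffices that the G-degrees of the leaves of T add up to at most
   n - |B(T)|: if |L(T)| + |B(T)| >= 2k+4, then |L(T)| >= k+3 since |B| <= |L| - 2, and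
   discarding all but k+3 leaves, each of degree at least 1, leaves a degree sum of at most
   n - k - 1, although the leaves are independent.

   To an edge ux of G at a leaf u attach the dart (z,x) of T, z being the neighbour of x towards
   u.  Exchanging zx for ux shows that z is not a branch vertex and that u is the only leaf that
   z may be adjacent to; with K_{1,4}-freeness, at most one leaf is attached to each dart.  So
   one must show that at most half of the darts with a tail of degree 2 are attached.  Reversing
   an attached dart gives an unattached one; only attached darts (z,b) with b a branch vertex
   need another partner.  If the leaf u is not adjacent to z, then by K_{1,4}-freeness the other
   neighbours of b form a clique, one of them, w, has degree 2, and (w,b) is the partner.  If u is
   adjacent to z, follow the path from b through z back, as long as the darts against the
   direction of travel are attached; the first dart where this fails is the partner. *)
Require Import Defs.
From mathcomp Require Import all_boot.
From mathcomp Require Import zify.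
From Stdlib Require Import Classical.

Set Implicit Arguments.
Unset Strict Implicit.
Unset Printing Implicit Defensive.

(** Trees are relations constrained by arbitrary propositions, so an extremal tree is found by
    classical descent on the number [f x]. *)
Lemma minimizer (T : Type) (P : T -> Prop) (f : T -> nat) :
  (exists x, P x) -> exists2 x, P x & forall y, P y -> f x <= f y.
Proof.
case=> x; have [m] := ubnP (f x); elim: m x => // m IH x; rewrite ltnS => xm Px.
case: (classic (exists2 y, P y & f y < f x)) => [[y Py yx]|no].
  exact: IH (leq_trans yx xm) Py.
by exists x => // y Py; rewrite leqNgt; apply/negP => yx; apply: no; exists y.
Qed.

(** * Trees and edge exchanges *)

Section Trees.
Variable V : finType.
Implicit Types (t s : rel V) (a b c d r u v w x y z : V).

Definition same_edge a b x y := (x == a) && (y == b) || (x == b) && (y == a).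

Definition del_edge t a b : rel V := fun x y => t x y && ~~ same_edge a b x y.
Definition add_edge t c d : rel V := fun x y => t x y || same_edge c d x y.
Definition exchange t a b c d : rel V := add_edge (del_edge t a b) c d.

Definition side t a b x := connect (del_edge t a b) a x.

(** Acyclicity is replaced by the edge count |V| - 1, written as a degree sum without subtraction,
    which exchanges preserve by arithmetic; [acyclic] recovers the absence of cycles. *)
Definition tree t :=
  [/\ symmetric t, irreflexive t, Defs.connected t &
      \sum_x deg t x + 2 = 2 * #|V|].

Lemma same_edgeP a b x y :
  reflect ((x = a /\ y = b) \/ (x = b /\ y = a)) (same_edge a b x y).
Proof.
apply: (iffP orP) => [[]/andP[/eqP-> /eqP->]|[[-> ->]|[-> ->]]]; auto;
  by rewrite !eqxx; auto.
Qed.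

Lemma same_edge_sym a b : symmetric (same_edge a b).
Proof. by move=> x y; rewrite /same_edge orbC ![(_ == b) && _]andbC ![(_ == a) && _]andbC. Qed.

Lemma same_edgeC a b x y : same_edge a b x y = same_edge b a x y.
Proof. by rewrite /same_edge orbC. Qed.

Lemma del_edge_sym t a b : symmetric t -> symmetric (del_edge t a b).
Proof. by move=> st x y; rewrite /del_edge st same_edge_sym. Qed.

Lemma add_edge_sym t a b : symmetric t -> symmetric (add_edge t a b).
Proof. by move=> st x y; rewrite /add_edge st same_edge_sym. Qed.

Lemma add_edge_irr t a b : a != b -> irreflexive t -> irreflexive (add_edge t a b).
Proof.
move=> ab it x; rewrite /add_edge it /=; apply/negbTE/same_edgeP.
by case=> [[xa xb]|[xb xa]]; move: ab; rewrite -xa -xb eqxx.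
Qed.

Lemma sym_connect t x y : symmetric t -> connect t x y = connect t y x.
Proof. by move=> /sym_connect_sym; apply. Qed.

Lemma connect_closed_ind t x (P : V -> Prop) : P x ->
  (forall y z, connect t x y -> t y z -> P y -> P z) ->
  forall y, connect t x y -> P y.
Proof.
move=> Px IH y /connectP[p]; elim/last_ind: p y => [|p z IHp] y /=; first by move=> _ ->.
rewrite rcons_path last_rcons => /andP[pp tz] ->.
by apply: IH tz (IHp _ pp erefl); apply/connectP; exists p.
Qed.

Lemma connect_subrel t s x :
  (forall y z, connect t x y -> t y z -> connect s y z) ->
  forall y, connect t x y -> connect s x y.
Proof.
move=> ts; apply: connect_closed_ind => [|y z xy tyz sxy]; first exact: connect0.
exact: connect_trans sxy (ts _ _ xy tyz).
Qed.

Lemma eq_deg t s : t =2 s -> deg t =1 deg s.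
Proof. by move=> ts x; apply: eq_card => y; rewrite !inE ts. Qed.

Lemma deg_subrel t s x : subrel t s -> deg t x <= deg s x.
Proof. by move=> ts; apply/subset_leq_card/subsetP => y; rewrite !inE; apply: ts. Qed.

Lemma deg_add_edge t c d x : symmetric t -> ~~ t c d -> c != d ->
  deg (add_edge t c d) x = deg t x + (x == c) + (x == d).
Proof.
move=> st tcd cd; rewrite /deg.
have [->|xc] := eqVneq x c.
  rewrite (negbTE cd) addn0.
  have -> : [set y | add_edge t c d c y] = d |: [set y | t c y].
    apply/setP=> y; rewrite !inE /add_edge /same_edge eqxx (negbTE cd) /= orbF orbC //.
  by rewrite cardsU1 inE tcd addnC.
have [->|xd] := eqVneq x d.
  have -> : [set y | add_edge t c d d y] = c |: [set y | t d y].
    apply/setP=> y; rewrite !inE /add_edge /same_edge eqxx eq_sym eq_sym.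
    by rewrite (eq_sym d) (negbTE cd) /= orbC.
  by rewrite cardsU1 inE st tcd addn0 addnC.
rewrite !addn0; apply: eq_card => y.
by rewrite !inE /add_edge /same_edge (negbTE xc) (negbTE xd) orbF.
Qed.

Lemma deg_del_edge t a b x : symmetric t -> t a b -> a != b ->
  deg (del_edge t a b) x + (x == a) + (x == b) = deg t x.
Proof.
move=> st tab ab; rewrite -deg_add_edge //; last 2 first.
- exact: del_edge_sym.
- by rewrite /del_edge /same_edge !eqxx andbF.
apply: eq_deg => y z; rewrite /add_edge /del_edge.
case: same_edgeP => [[[-> ->]|[-> ->]]|_]; rewrite ?andbF ?andbT ?orbF ?orbT ?tab //.
by rewrite st tab.
Qed.

Lemma sum_eq1 a : \sum_x ((x == a) : nat) = 1.
Proof. by rewrite (bigD1 a) //= eqxx big1 // => i /negbTE->. Qed.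

Lemma sum_const n : \sum_(x : V) n = #|V| * n.
Proof. by rewrite -sum_nat_const; apply: eq_bigl. Qed.

Lemma card_set_sum (A : {set V}) : #|A| = \sum_x (x \in A).
Proof. by rewrite -sum1_card big_mkcond; apply: eq_bigr => x _; case: ifP. Qed.

Lemma connected_edge_rel t s : Defs.connected t ->
  (forall x y, t x y -> connect s x y) -> Defs.connected s.
Proof. by move=> ct ts x y; apply: connect_subrel (ct x y) => ? ? _; apply: ts. Qed.

Lemma spanning_subtree t r : symmetric t -> irreflexive t -> Defs.connected t ->
  exists s, subrel s t /\ tree s.
Proof.
move=> st it ct.
(* A subtree with [m] edges and vertex set [S] grows from [r]: each round adds an edge of [t] that
   leaves [S]. *)
have H m : m < #|V| -> exists (S : {set V}) s,
   [/\ r \in S, #|S| = m.+1 & subrel s t] /\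
   [/\ symmetric s, {in S, forall x, connect s r x},
      forall x y, s x y -> x \in S & \sum_x deg s x = 2 * m].
  elim: m => [_|m IH lm].
    exists [set r], (fun _ _ => false); split; split => //; first by rewrite set11.
    - by rewrite cards1.
    - by move=> x; rewrite inE => /eqP->; exact: connect0.
    - by rewrite big1 // => x _; apply/eqP; rewrite cards_eq0; apply/eqP/setP=> y; rewrite !inE.
  have [S [s [[rS cS ss] [sys cs sS sum]]]] := IH (ltnW lm).
  have [x [y [xS yS txy]]] : exists x y, [/\ x \in S, y \notin S & t x y].
    apply: NNPP => no.
    have all_in y : y \in S.
      apply: (@connect_closed_ind t r (fun y => y \in S)) (ct r y) => //.
      move=> a b _ tab aS; case: (boolP (b \in S)) => // bS.
      by case: no; exists a, b.
    move: lm; have -> : #|V| = #|S| by apply: eq_card => z; rewrite all_in.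
    by rewrite cS ltnn.
  have xy : x != y by apply: contraNneq yS => <-.
  have nsxy : ~~ s x y by apply: contraNN yS; rewrite sys; apply: sS.
  exists (y |: S), (add_edge s x y); split; split.
  - by rewrite inE rS orbT.
  - by rewrite cardsU1 yS cS.
  - move=> a b /orP[/ss//|/same_edgeP[[-> ->]//|[-> ->]]]; by rewrite st.
  - exact: add_edge_sym.
  - have sub a b : connect s a b -> connect (add_edge s x y) a b.
      by apply: connect_sub => {}a {}b sab; apply: connect1; rewrite /add_edge sab.
    move=> a; rewrite !inE => /predU1P[->|aS]; last exact/sub/cs.
    apply: connect_trans (sub _ _ (cs _ xS)) (connect1 _).
    by rewrite /add_edge /same_edge !eqxx orbT.
  - move=> a b /orP[/sS|/same_edgeP[[-> _]|[-> _]]]; rewrite !inE ?eqxx ?xS ?orbT //.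
    by move->; rewrite orbT.
  - under eq_bigr => a _ do rewrite deg_add_edge //.
    by rewrite !big_split /= !sum_eq1 sum; lia.
have V0 : 0 < #|V| by apply/card_gt0P; exists r.
case: (H #|V|.-1); first by lia.
move=> S [s [[rS cS ss] [sys cs sS sum]]]; exists s; split => //; split => //.
- by move=> x; apply/negP => /ss; rewrite it.
- have inS x : x \in S.
    have /eqP-> : S == setT by rewrite eqEcard subsetT cardsT cS prednK /=.
    by rewrite inE.
  move=> x y; apply: connect_trans (cs _ (inS y)).
  by rewrite sym_connect // cs.
- by rewrite sum; lia.
Qed.

Lemma connected_sum_deg t r : symmetric t -> irreflexive t -> Defs.connected t ->
  2 * #|V| <= \sum_x deg t x + 2.
Proof.
move=> st it ct; have [s [ss [_ _ _ <-]]] := spanning_subtree r st it ct.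
by rewrite leq_add2r; apply: leq_sum => x _; apply: deg_subrel.
Qed.

(** * Bridges, sides of an edge and leaf counts in a tree *)

Section Tree.
Variable t : rel V.
Hypothesis tt : tree t.

Let st : symmetric t. Proof. by case: tt. Qed.
Let it : irreflexive t. Proof. by case: tt. Qed.
Let ct : Defs.connected t. Proof. by case: tt. Qed.

Lemma tree_edge_neq a b : t a b -> a != b.
Proof. by apply: contraTneq => ->; rewrite it. Qed.

(** Otherwise deleting [ab] would leave a connected graph with only |V| - 2 edges. *)
Lemma bridge a b : t a b -> ~~ connect (del_edge t a b) a b.
Proof.
move=> tab; apply/negP => cab; have ab := tree_edge_neq tab.
have cd : Defs.connected (del_edge t a b).
  apply: connected_edge_rel ct _ => x y txy.
  case: (boolP (same_edge a b x y)) => [/same_edgeP[[-> ->]//|[-> ->]]|ne].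
    by rewrite sym_connect //; apply: del_edge_sym.
  by apply: connect1; rewrite /del_edge txy.
have id : irreflexive (del_edge t a b) by move=> x; rewrite /del_edge it.
have := connected_sum_deg a (del_edge_sym a b st) id cd.
case: tt => _ _ _ <-.
under [in leqLHS]eq_bigr => x _ do rewrite -(deg_del_edge x st tab ab).
by rewrite !big_split /= !sum_eq1; lia.
Qed.

Lemma sideC a b x : connect (del_edge t a b) b x = side t b a x.
Proof. by apply: eq_connect => y z; rewrite /del_edge same_edgeC. Qed.

Lemma side_refl a b : side t a b a. Proof. exact: connect0. Qed.

Lemma side_excl a b x : t a b -> side t a b x -> ~~ side t b a x.
Proof.
move=> /bridge/negP nab sa; apply/negP; rewrite -sideC => sb; apply: nab.
by apply: connect_trans sa _; rewrite sym_connect //; apply: del_edge_sym.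
Qed.

Lemma side_edge a b x y : t x y -> ~~ same_edge a b x y ->
  side t a b x -> side t a b y.
Proof.
by move=> txy ne sx; apply: connect_trans sx (connect1 _); rewrite /del_edge txy.
Qed.

Lemma side_total a b x : t a b -> side t a b x || side t b a x.
Proof.
move=> tab; apply: (@connect_closed_ind t a (fun x => side t a b x || side t b a x)) (ct a x).
  by rewrite (side_refl a b).
move=> y z _ tyz; case: (boolP (same_edge a b y z)) => [/same_edgeP[[-> ->]|[-> ->]]|ne].
- by rewrite (side_refl b a) orbT.
- by rewrite (side_refl a b).
by case/orP => sy; apply/orP; [left|right]; apply: side_edge sy; rewrite // same_edgeC.
Qed.

Lemma sideN a b x : t a b -> side t b a x = ~~ side t a b x.
Proof.
move=> tab; case: (boolP (side t a b x)) => [/(side_excl tab)/negbTE//|ns].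
by have := side_total x tab; rewrite (negbTE ns).
Qed.

(** This gives the first step of the path from [x] to [r], so that paths can be handled through
    sides of edges. *)
Lemma toward x r : x != r -> exists2 y, t x y & side t y x r.
Proof.
move=> xr; suff /(_ r (ct x r)) [rx|//] : forall r, connect t x r ->
    r = x \/ exists2 y, t x y & side t y x r.
  by rewrite rx eqxx in xr.
apply: connect_closed_ind; first by left.
move=> y z _ tyz IH; have [->|zx] := eqVneq z x; first by left.
right; case: IH => [yx|[c txc sc]].
  by rewrite yx in tyz; exists z => //; apply: side_refl.
exists c => //; have [yx|yx] := eqVneq y x.
  have tcx : t c x by rewrite st.
  by move: (side_excl tcx sc); rewrite yx side_refl.
apply: side_edge sc => //; apply/same_edgeP.
by case=> [[_ /eqP]|[/eqP]]; rewrite ?(negbTE zx) ?(negbTE yx).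
Qed.

(* With [a - b - c] a path, the component of [a] misses [b], hence the edge [bc]. *)
Lemma side_nest a b c x : t a b -> t b c -> a != c ->
  side t a b x -> side t b c x.
Proof.
move=> tab tbc ac; move: x.
apply: (@connect_closed_ind _ _ (fun x => side t b c x)).
  apply: connect1; rewrite /del_edge st tab /=; apply/same_edgeP.
  by case=> [[_ /eqP]|[/eqP + _]]; rewrite ?(negbTE ac) // (negbTE (tree_edge_neq tbc)).
move=> y z sy /[dup] dyz /andP[tyz _]; apply: side_edge => //.
have next_nbr : ~~ side t a b b by rewrite -(sideN _ _) ?side_refl // st.
have sz : side t a b z by apply: connect_trans sy (connect1 dyz).
apply/same_edgeP => -[[yb _]|[_ zb]]; move/negP: next_nbr; apply.
  by move: sy; rewrite yb.
by move: sz; rewrite zb.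
Qed.

Lemma toward_uniq x r y z : t x y -> t x z -> side t y x r -> side t z x r -> y = z.
Proof.
move=> txy txz sy sz; apply: contraTeq sz => yz; rewrite sideN //.
by rewrite negbK; apply: side_nest sy => //; rewrite st.
Qed.

Lemma side_notin a b : t a b -> ~~ side t a b b.
Proof. by move=> tab; rewrite -sideN // side_refl. Qed.

Lemma side_step a b x : t a b -> side t a b x -> x != a ->
  exists c, [/\ t a c, c != b & side t c a x].
Proof.
move=> tab sx xa; have [|c tac sc] := @toward a x; first by rewrite eq_sym.
exists c; split => //; apply: contraTneq sc => ->.
by rewrite sideN // negbK.
Qed.

(** Carries a whole side over to a modified tree: only the edges inside that side have to
    survive. *)
Lemma side_connect s a b x :
  (forall y z, t y z -> side t a b y -> side t a b z -> connect s y z) ->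
  side t a b x -> connect s a x.
Proof.
move=> H; move: x; apply: connect_subrel => y z sy /[dup] dyz /andP[tyz _].
by apply: H => //; apply: connect_trans sy (connect1 dyz).
Qed.

Lemma deg_ge (l : seq V) x : uniq l -> all (t x) l -> size l <= deg t x.
Proof.
move=> /card_uniqP <- /allP H; apply/subset_leq_card/subsetP => y /H.
by rewrite inE.
Qed.

Lemma nbr_notin (l : seq V) x : size l < deg t x -> exists2 y, t x y & y \notin l.
Proof.
move=> ll; have /subsetPn[y] : ~~ ([set y | t x y] \subset l).
  apply: contraL ll => /subset_leq_card sl; rewrite -leqNgt.
  exact: leq_trans sl (card_size _).
by rewrite inE => txy yl; exists y.
Qed.

Lemma nbr_in (l : seq V) x y : uniq l -> all (t x) l -> deg t x = size l -> t x y ->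
  y \in l.
Proof.
move=> ul al dl txy; apply/negPn/negP => yl.
have := @deg_ge (y :: l) x; rewrite /= yl ul txy al dl ltnn => H.
by have := H isT isT.
Qed.

Lemma leafP u : u \in leaves t -> exists2 q, t u q & forall x, t u x -> x = q.
Proof.
rewrite inE => /eqP du; have [|q tq _] := @nbr_notin [::] u; first by rewrite du.
exists q => // x tx; have := @nbr_in [:: q] u x; rewrite /= tq du inE.
by move=> H; apply/eqP/H.
Qed.

Lemma side_leaf u q x : u \in leaves t -> t u q -> side t u q x -> x = u.
Proof.
move=> /leafP[p tp up] tq sx; apply/eqP; apply: contraT => xu.
by have [c [/up-> ]] := side_step tq sx xu; rewrite (up _ tq) eqxx.
Qed.

Lemma deg_gt0 x : 1 < #|V| -> 0 < deg t x.
Proof.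
move=> V1; have [y] : exists y, y \in [set~ x].
  by apply/card_gt0P; rewrite cardsC1; lia.
rewrite !inE eq_sym => /toward[c txc _].
by apply: (@deg_ge [:: c] x); rewrite //= txc.
Qed.

(** At each vertex, 2 plus the branch indicator is at most the degree plus the leaf indicator; the
    degrees add up to 2|V| - 2. *)
Lemma leaves_branch : 1 < #|V| -> #|branch_vertices t| + 2 <= #|leaves t|.
Proof.
move=> V1; suff : #|V| * 2 + #|branch_vertices t| <= \sum_x deg t x + #|leaves t|.
  by case: tt => _ _ _; lia.
rewrite -sum_const !card_set_sum -!big_split /=; apply: leq_sum => x _.
by have := deg_gt0 x V1; rewrite !inE; lia.
Qed.

(** If all degrees were at most 2, the degree plus the leaf indicator would be at most 2 everywhere,
    which leaves room for two leaves only. *)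
Lemma branch_ex : 2 < #|leaves t| -> exists r, 2 < deg t r.
Proof.
move=> L3; apply: NNPP => no.
suff : \sum_x deg t x + #|leaves t| <= #|V| * 2.
  by case: tt => _ _ _; lia.
rewrite -sum_const card_set_sum -!big_split /=; apply: leq_sum => x _.
rewrite inE; have : deg t x <= 2 by rewrite leqNgt; apply/negP => ?; apply: no; exists x.
by lia.
Qed.

(** The rest of a cycle would join the ends of its closing edge, which is a bridge. *)
Lemma acyclic : ~ has_cycle t.
Proof.
case=> x [p [sp up pp tlx]]; case: p sp up pp tlx => [|a [|b p]] //=.
move=> _ /andP[xp /andP[ap _]] /andP[txa pp] tlx.
set y := last b p in tlx; have txy : t x y by rewrite st.
have /negP := bridge txy; apply; apply: (@connect_trans _ _ a).
  apply: connect1; rewrite /del_edge txa /=; apply/same_edgeP.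
  case=> [[_ ay]|[xy _]]; first by move: ap; rewrite ay mem_last.
  by move: xp; rewrite xy in_cons mem_last orbT.
have avoid l : forall z, x \notin z :: l -> path t z l ->
    connect (del_edge t x y) z (last z l); last exact: (avoid (b :: p) a xp pp).
elim: l => [|c l IH] z /=; first by move=> _ _; apply: connect0.
rewrite in_cons negb_or => /andP[xz xl] /andP[tzc pl].
apply: (connect_trans (connect1 _) (IH _ xl pl)); rewrite /del_edge tzc /=.
apply/same_edgeP; case=> [[zx _]|[_ cx]]; first by rewrite zx eqxx in xz.
by move: xl; rewrite inE cx eqxx.
Qed.

Lemma tree_exchange a b c d : t a b -> c != d -> connect (exchange t a b c d) a b ->
  tree (exchange t a b c d) /\
  forall x, deg (exchange t a b c d) x + (x == a) + (x == b)
            = deg t x + (x == c) + (x == d).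
Proof.
move=> tab cd cab; have ab := tree_edge_neq tab.
have ss : symmetric (exchange t a b c d) by apply/add_edge_sym/del_edge_sym.
have is' : irreflexive (exchange t a b c d).
  by apply: add_edge_irr => // x; rewrite /del_edge it.
have cs : Defs.connected (exchange t a b c d).
  apply: connected_edge_rel ct _ => x y txy.
  case: (boolP (same_edge a b x y)) => [/same_edgeP[[-> ->]//|[-> ->]]|ne].
    by rewrite sym_connect.
  by apply: connect1; rewrite /exchange /add_edge /del_edge txy ne.
have sd : forall x, deg (del_edge t a b) x + (x == a) + (x == b) = deg t x.
  by move=> x; apply: deg_del_edge.
have sumd : \sum_x deg (del_edge t a b) x + 2 = \sum_x deg t x.
  under [in RHS]eq_bigr => x _ do rewrite -sd.
  by rewrite !big_split /= !sum_eq1; lia.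
have tsum : \sum_x deg t x + 2 = 2 * #|V| by case: tt.
(* If [cd] were still present after the deletion, the exchange would be a connected graph with |V| -
   2 edges. *)
have ndel : ~~ del_edge t a b c d.
  apply/negP => dcd; have := connected_sum_deg a ss is' cs.
  suff -> : \sum_x deg (exchange t a b c d) x = \sum_x deg (del_edge t a b) x by lia.
  apply: eq_bigr => x _; apply: eq_deg => y z; rewrite /exchange /add_edge.
  case: same_edgeP => [[[-> ->]|[-> ->]]|_]; rewrite ?orbF // orbT ?dcd //.
  by rewrite del_edge_sym.
have dd x : deg (exchange t a b c d) x = deg (del_edge t a b) x + (x == c) + (x == d).
  by apply: deg_add_edge => //; apply: del_edge_sym.
split; last by move=> x; rewrite dd -sd; lia.
split=> //; under eq_bigr => x _ do rewrite dd.
by rewrite !big_split /= !sum_eq1 -tsum -sumd -!addnA.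
Qed.

(* An edge on the path from [u] to [v], just before the path from [u] to [r] branches off. *)
Lemma branch_edge u v r : u \in leaves t -> v \in leaves t -> u != v -> 2 < deg t r ->
  exists b c, [/\ 2 < deg t b, t c b, side t c b u & side t b c v].
Proof.
move=> Lu Lv uv dr; have [q tuq uq] := leafP Lu.
(* Among the edges [cb] that separate [u] from [v] and [r], one with the smallest side of [b] is
   taken; the edge at the leaf [u] is a first candidate. *)
pose P m := exists b c, [/\ t c b, side t c b u, side t b c v & side t b c r] /\
   m = #|[set x | side t b c x]|.
have ru : r != u by apply: contraTneq dr => ->; move: Lu; rewrite inE => /eqP->.
have rv : r != v by apply: contraTneq dr => ->; move: Lv; rewrite inE => /eqP->.
have PN : exists m, P m.
  have out x : x != u -> side t q u x.
    by move=> xu; rewrite sideN //; apply: contraNN xu => /(side_leaf Lu tuq)/eqP.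
  exists #|[set x | side t q u x]|, q, u; split => //; split => //.
  - exact: side_refl.
  - by apply: out; rewrite eq_sym.
  - exact: out.
have [m [b [c [[tcb su sv sr] mE]]] min] := minimizer id PN.
have tbc : t b c by rewrite st.
exists b, c; split => //; have [rb|rb] := eqVneq r b; first by rewrite -rb.
have vb : v != b.
  apply: contraNneq rv => vb; apply/eqP; rewrite vb; apply: side_leaf tbc sr.
  by rewrite -vb.
have [d [tbd dc sd]] := side_step tbc sv vb.
have [f [tbf fc sf]] := side_step tbc sr rb.
(* If the ways from [b] to [v] and to [r] part, then [c], [d], [f] are three neighbours of [b];
   otherwise the edge [bd] has a smaller side. *)
have [fd|fd] := eqVneq f d; last first.
  apply: (@deg_ge [:: c; d; f] b); rewrite /= ?tbc ?tbd ?tbf // !inE.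
  by rewrite negb_or (eq_sym c) dc (eq_sym c) fc (eq_sym d) fd.
have tdb : t d b by rewrite st.
suff: m < m by rewrite ltnn.
apply: leq_ltn_trans (min #|[set x | side t d b x]| _) _.
  exists d, b; split => //; split => //; last by rewrite -fd.
  by apply: side_nest su => //; rewrite eq_sym.
rewrite mE; apply/proper_card/properP; split.
  by apply/subsetP => x; rewrite !inE; apply: side_nest.
by exists b; rewrite inE ?side_refl ?side_notin.
Qed.

End Tree.
End Trees.

(** * Sliding an edge along an adjacent edge *)

Section Slide.
Variables (V : finType) (t : rel V).
Hypothesis tt : tree t.
Implicit Types (a b c d r u v w x y z : V).

Let st : symmetric t. Proof. by case: tt. Qed.

Lemma side_nbr a b c : t a b -> t b c -> a != c -> side t b a c.
Proof.
move=> tab tbc ac; apply: connect1; rewrite /del_edge tbc /=; apply/same_edgeP.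
case=> [[_ /eqP]|[/eqP ba _]]; first by rewrite eq_sym (negbTE ac).
by have := tree_edge_neq tt tab; rewrite eq_sym ba.
Qed.

Lemma side_neq a b x : t a b -> side t a b x -> x != b.
Proof. by move=> tab; apply: contraTneq => ->; apply: side_notin. Qed.

Lemma side_nbr_neq a b c x : t a b -> t b c -> a != c -> side t a b x -> x != c.
Proof.
move=> tab tbc ac sx; apply: contraTneq sx => ->.
by rewrite -sideN ?side_nbr // st.
Qed.

Lemma no_triangle a b c : t a b -> t b c -> t a c -> False.
Proof.
move=> tab tbc tac; have ac := tree_edge_neq tt tac; have bc := tree_edge_neq tt tbc.
have := side_nbr_neq tab tbc ac; move/(_ c); rewrite eqxx => H; apply/notF/H.
apply: side_edge tac _ (side_refl t a b); apply/same_edgeP.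
case=> [[_ cb]|[ab _]]; first by rewrite cb eqxx in bc.
by have := tree_edge_neq tt tab; rewrite ab eqxx.
Qed.

(* [s] slides the edge [bw'] to [ww'] along the edge [bw]. *)
Lemma slide_tree b w w' (s := exchange t b w' w' w) : t b w -> t b w' -> w != w' ->
  tree s /\ forall y, deg s y + (y == b) = deg t y + (y == w).
Proof.
move=> tw tw' ww'.
have bw := tree_edge_neq tt tw; have bw' := tree_edge_neq tt tw'.
have [| |ts ds] := @tree_exchange _ _ tt b w' w' w tw'; first by rewrite eq_sym.
  apply: (@connect_trans _ _ w); apply: connect1; rewrite /exchange /add_edge /del_edge.
    rewrite tw /=; apply/orP; left; apply/same_edgeP.
    by case=> [[_ /eqP]|[/eqP + _]]; rewrite ?(negbTE ww') ?(negbTE bw').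
  by rewrite /same_edge !eqxx orbT orbT.
by split => // y; have := ds y; rewrite -/s; lia.
Qed.

Lemma slide_edge b w w' x y : t x y -> ~~ same_edge b w' x y -> exchange t b w' w' w x y.
Proof. by move=> txy ne; rewrite /exchange /add_edge /del_edge txy ne. Qed.

(** The lost edge [bw'] is replaced by the walk [b], [w], [w'], which by the two conditions on [pq]
    does not use [pq]. *)
Lemma slide_side b w w' p q x (s := exchange t b w' w' w) : t b w -> t b w' -> w != w' ->
  ~~ same_edge p q b w -> ~~ same_edge p q w w' ->
  side t p q x -> side s p q x.
Proof.
move=> tw tw' ww' n1 n2.
have bw' := tree_edge_neq tt tw'.
have ss : symmetric s by apply/add_edge_sym/del_edge_sym.
have cbw : connect (del_edge s p q) b w'.
  apply: (@connect_trans _ _ w); apply: connect1; rewrite /del_edge ?n1 ?n2 ?andbT.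
    apply: slide_edge => //; apply/same_edgeP.
    by case=> [[_ /eqP]|[/eqP + _]]; rewrite ?(negbTE ww') ?(negbTE bw').
  by rewrite /s /exchange /add_edge /same_edge !eqxx !orbT.
move: x; apply: connect_subrel => y z _ /andP[tyz npq].
case: (boolP (same_edge b w' y z)) => [/same_edgeP[[-> ->]//|[-> ->]]|ne].
  by rewrite sym_connect //; apply: del_edge_sym.
by apply: connect1; rewrite /del_edge npq /s slide_edge.
Qed.

End Slide.

(** * Spanning trees with the fewest leaves *)

Section Optimal.
Variables (V : finType) (e : rel V).
Hypothesis es : symmetric e.
Hypothesis ei : irreflexive e.
Hypothesis K14 : K14_free e.
(** This will follow from the assumption that every spanning tree violates the bound of the theorem;
    it provides a branch vertex. *)
Hypothesis three_leaves : forall t, tree t -> subrel t e -> 2 < #|leaves t|.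
Implicit Types (t s : rel V) (a b c r u v w x y z : V) (d : V * V).

Definition min_leaves t := [/\ tree t, subrel t e &
  forall s, tree s -> subrel s e -> #|leaves t| <= #|leaves s|].

(* [u] is a leaf on the side of [z] of the tree edge [zx] and [ux] is an edge of [e]. *)
Definition chord t z x u := [&& t z x, u \in leaves t, side t z x u & e u x].

Lemma K14_edge c a1 a2 a3 a4 : e c a1 -> e c a2 -> e c a3 -> e c a4 ->
  uniq [:: a1; a2; a3; a4] ->
  ~~ [|| e a1 a2, e a1 a3, e a1 a4, e a2 a3, e a2 a4 | e a3 a4] -> False.
Proof.
move=> e1 e2 e3 e4 un; rewrite !negb_or => /and5P[n12 n13 n14 n23].
case/andP=> n24 n34.
apply: K14; exists c, [set x in [:: a1; a2; a3; a4]]; split.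
- by rewrite cardsE (card_uniqP un).
- apply/forall_inP => x; rewrite !inE => xs; apply/forall_inP => y; rewrite !inE => ys.
  by case/or4P: xs => /eqP->; case/or4P: ys => /eqP->; rewrite ?ei // es.
- by move=> y; rewrite !inE => /or4P[] /eqP->.
Qed.

Lemma subrel_exchange t a b c (d : V) : subrel t e -> e c d -> subrel (exchange t a b c d) e.
Proof.
move=> te ecd x y /orP[/andP[/te//]|/same_edgeP[[-> ->]//|[-> ->]]].
by rewrite es.
Qed.

Lemma min_leaves_contra t s u : min_leaves t -> tree s -> subrel s e -> u \in leaves t ->
  (forall y, y \in leaves s -> y \in leaves t /\ y != u) -> False.
Proof.
move=> [_ _ mt] ts se ut H; have := mt s ts se; rewrite leqNgt => /negP; apply.
rewrite (cardsD1 u (leaves t)) ut ltnS; apply/subset_leq_card/subsetP => y /H[yt yu].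
by rewrite !inE yu /=; move: yt; rewrite inE.
Qed.

Lemma min_leaves_replace t s u w : min_leaves t -> tree s -> subrel s e -> u \in leaves t ->
  (forall y, y \in leaves s -> y = w \/ y \in leaves t /\ y != u) -> min_leaves s.
Proof.
move=> [_ _ mt] ts se ut H; split => // r tr re; apply: leq_trans (mt r tr re).
have : leaves s \subset w |: leaves t :\ u.
  apply/subsetP => y /H[->|[yt yu]]; first exact: setU11.
  by apply/setU1P; right; apply/setD1P.
move=> /subset_leq_card /leq_trans; apply; rewrite [leqRHS](cardsD1 u) ut.
by rewrite cardsU1 leq_add2r leq_b1.
Qed.

Lemma min_leaves_subset t s : min_leaves t -> tree s -> subrel s e ->
  leaves s \subset leaves t -> min_leaves s.
Proof.
move=> [_ _ mt] ts se /subset_leq_card ls; split => // r tr re.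
exact: leq_trans ls (mt r tr re).
Qed.

(** Adding [uv] and deleting an edge [cb] of the resulting cycle at a branch vertex [b] leaves at
    most the leaf [c] in place of [u] and [v]. *)
Lemma min_leaves_indep t u v : min_leaves t -> u \in leaves t -> v \in leaves t -> ~~ e u v.
Proof.
move=> ot; have [tt te mt] := ot => Lu Lv; apply/negP => euv.
have L3 := three_leaves tt te.
case: (eqVneq u v) => [uv|uv]; first by rewrite uv ei in euv.
have [r dr] := branch_ex tt L3.
have [b [c [db tcb su sv]]] := branch_edge tt Lu Lv uv dr.
have [st _ _ _] := tt.
have tbc : t b c by rewrite st.
have bv : v != b by apply: contraTneq db => <-; move: Lv; rewrite inE => /eqP->.
have bu : u != b := side_neq tt tcb su.
have cv : v != c := side_neq tt tbc sv.
have sub x y : connect (del_edge t c b) x y -> connect (exchange t c b u v) x y.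
  by apply: connect_sub => {}x {}y dxy; apply: connect1; rewrite /exchange /add_edge dxy.
have [|ts ds] := @tree_exchange _ _ tt c b u v tcb uv.
  apply: connect_trans (sub _ _ su) (@connect_trans _ _ v _ _ _ _).
    by apply: connect1; rewrite /exchange /add_edge /same_edge !eqxx orbT.
  apply: sub; rewrite sym_connect; last exact: del_edge_sym.
  by rewrite sideC.
have := mt _ ts (subrel_exchange te euv); rewrite leqNgt => /negP; apply.
have : leaves (exchange t c b u v) \subset c |: (leaves t :\ u :\ v).
  apply/subsetP => y; rewrite !inE; have := ds y.
  have [->//|yc] := eqVneq y c; have [->|yb] := eqVneq y b.
    rewrite eq_sym (negbTE bu) eq_sym (negbTE bv); move: db; clear; lia.
  move: Lu Lv; rewrite !inE => /eqP Lu /eqP Lv.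
  have [->|yu] := eqVneq y u; first by rewrite Lu; clear; lia.
  have [->|yv] := eqVneq y v; first by rewrite Lv; clear; lia.
  by rewrite /= !addn0 => ->.
move=> /subset_leq_card /leq_ltn_trans; apply.
have Lv' : v \in leaves t :\ u by apply/setD1P; rewrite eq_sym.
rewrite (cardsD1 u (leaves t)) Lu (cardsD1 v (leaves t :\ u)) Lv' cardsU1.
by case: (c \notin _).
Qed.

Lemma many_vertices t : min_leaves t -> 1 < #|V|.
Proof.
case=> tt te _; have := three_leaves tt te.
by move=> /leq_trans/(_ (max_card _))/ltnW.
Qed.

Lemma min_leaves_deg_gt0 t x : min_leaves t -> 0 < deg t x.
Proof. by move=> ot; have [tt _ _] := ot; apply: deg_gt0 (many_vertices ot). Qed.

Lemma mem_leaves t u : (u \in leaves t) = (deg t u == 1).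
Proof. by rewrite inE. Qed.

Lemma tree_sym t : tree t -> symmetric t. Proof. by case. Qed.

(** * Exchanges along chords *)

Lemma chordP t z x u : reflect [/\ t z x, u \in leaves t, side t z x u & e u x]
  (chord t z x u).
Proof. exact: and4P. Qed.

Lemma chord_neq t z x u : min_leaves t -> chord t z x u -> u != x.
Proof. by move=> [tt _ _] /chordP[tzx _ su _]; apply: side_neq su. Qed.

(** One unit of degree moves from [z] to [u]. The case [z = u], where the chord is a tree edge, is
    allowed and changes nothing. *)
Lemma chord_exchange_tree t z x u (s := exchange t z x u x) : min_leaves t -> chord t z x u ->
  [/\ tree s, subrel s e & forall y, deg s y + (y == z) = deg t y + (y == u)].
Proof.
move=> ot ow; have ux := chord_neq ot ow; have [tt te _] := ot.
have [tzx Lu su eux] := chordP _ _ _ _ ow.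
have [|ts ds] := @tree_exchange _ _ tt z x u x tzx ux.
  apply: (@connect_trans _ _ u).
    apply: connect_sub su => a b dab; apply: connect1; by rewrite /exchange /add_edge dab.
  by apply: connect1; rewrite /exchange /add_edge /same_edge !eqxx orbT.
split => //; first exact: subrel_exchange.
by move=> y; have := ds y; rewrite -/s; clear; lia.
Qed.

(** Otherwise the exchange would turn [u] into an inner vertex and leave [z] with degree at least 2,
    which saves a leaf. *)
Lemma chord_tail t z x u : min_leaves t -> chord t z x u -> deg t z <= 2.
Proof.
move=> ot ow; rewrite leqNgt; apply/negP => dz.
have [ts se ds] := chord_exchange_tree ot ow; have [_ Lu _ _] := chordP _ _ _ _ ow.
apply: (min_leaves_contra ot ts se Lu) => y; rewrite !mem_leaves; have := ds y.
move: Lu; rewrite mem_leaves => /eqP Lu.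
have [->|yz] := eqVneq y z.
  by case: (z == u); move: dz; clear; lia.
have [->|yu] := eqVneq y u; first by rewrite Lu; clear; lia.
by rewrite !addn0 => ->.
Qed.

Lemma chord_tail2 t z x u : min_leaves t -> chord t z x u -> z != u -> deg t z = 2.
Proof.
move=> ot ow zu; have := chord_tail ot ow.
have [tt _ _] := ot; have [tzx Lu su _] := chordP _ _ _ _ ow.
have [|c [tzc cx _]] := side_step tt tzx su; first by rewrite eq_sym.
have := @deg_ge _ t [:: c; x] z; rewrite /= inE cx tzc tzx => /(_ isT isT).
by clear; lia.
Qed.

Lemma chord_exchange_min t z x u (s := exchange t z x u x) :
  min_leaves t -> chord t z x u -> min_leaves s.
Proof.
move=> ot ow; have [ts se ds] := chord_exchange_tree ot ow; have [_ Lu _ _] := chordP _ _ _ _ ow.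
apply: (@min_leaves_replace t s u z) => // y; rewrite !mem_leaves; have := ds y; rewrite -/s.
have [->|yz] := eqVneq y z; first by left.
move: Lu; rewrite mem_leaves => /eqP Lu.
have [->|yu] := eqVneq y u; first by rewrite Lu; clear; lia.
by rewrite !addn0 => ->; right.
Qed.

(** For [z] other than [u], both [z] and [v] are leaves of the exchanged tree, which again has the
    fewest leaves. *)
Lemma chord_tail_nonadj t z x u v : min_leaves t -> chord t z x u -> v \in leaves t ->
  v != u -> ~~ e z v.
Proof.
move=> ot ow Lv vu; have [_ Lu _ _] := chordP _ _ _ _ ow.
have [->|zu] := eqVneq z u; first exact: min_leaves_indep ot Lu Lv.
have [ts se ds] := chord_exchange_tree ot ow; have dz := chord_tail2 ot ow zu.
have vz : v != z by apply: contraTneq Lv => ->; rewrite mem_leaves dz.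
apply: (min_leaves_indep (chord_exchange_min ot ow)); rewrite mem_leaves.
  by have := ds z; rewrite eqxx (negbTE zu) dz; clear; lia.
by have := ds v; rewrite (negbTE vz) (negbTE vu) !addn0 => ->; rewrite -mem_leaves.
Qed.

Lemma chord_head t z x u : min_leaves t -> chord t z x u -> 1 < deg t x.
Proof.
move=> ot ow; have := min_leaves_deg_gt0 x ot; have [_ Lu _ eux] := chordP _ _ _ _ ow.
rewrite leq_eqVlt => /predU1P[dx|//].
by have := min_leaves_indep (v := x) ot Lu; rewrite eux mem_leaves -dx => /(_ isT).
Qed.

(** If [zw] were an edge, exchanging [zx] for [ux] and then [xw] for [zw] would move one unit of
    degree from [x] to [u]. At a branch vertex [x] this saves a leaf; otherwise [x] becomes a leaf
    of an optimal tree although it is adjacent to the leaf [v]. *)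
Lemma chord_nbr_nonadj t z x u w : min_leaves t -> chord t z x u -> t x w -> w != z ->
  2 < deg t x \/ (exists v, [/\ v \in leaves t, v != u & e v x]) -> ~~ e z w.
Proof.
move=> ot ow txw wz alt; apply/negP => ezw.
have [ts1 s1e ds1] := chord_exchange_tree ot ow; have [tt te _] := ot; have st := tree_sym tt.
have ux := chord_neq ot ow; have dx := chord_head ot ow.
have [tzx Lu su eux] := chordP _ _ _ _ ow.
have zw : z != w by rewrite eq_sym.
have xz : x != z by rewrite eq_sym (tree_edge_neq tt tzx).
have xw : x != w := tree_edge_neq tt txw.
have uw : u != w := side_nbr_neq tt tzx txw zw su.
set s1 := exchange t z x u x in ts1 s1e ds1; pose s2 := exchange s1 x w z w.
have s1xw : s1 x w.
  rewrite /s1 /exchange /add_edge /del_edge txw /=; apply/orP; left; apply/same_edgeP.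
  by case=> [[/eqP]|[_ /eqP]]; rewrite ?(negbTE xz) ?(negbTE wz).
(* The new tree joins [x] to [w] through [u], the old path from [u] to [z], and the edge [zw]. *)
have cs2 : connect s2 x w.
  apply: (@connect_trans _ _ u).
    apply: connect1; rewrite /s2 {1}/exchange /add_edge /del_edge; apply/orP; left.
    rewrite /s1 /exchange /add_edge [same_edge u x x u]/same_edge !eqxx !orbT /=; apply/same_edgeP.
    by case=> [[_ /eqP]|[/eqP]]; rewrite ?(negbTE uw) ?(negbTE xw).
  apply: (@connect_trans _ _ z); last first.
    by apply: connect1; rewrite /s2 /exchange /add_edge /same_edge !eqxx !orbT.
  have ss2 : symmetric s2 by apply/add_edge_sym/del_edge_sym/tree_sym.
  rewrite sym_connect //; apply: side_connect su => a b tab sa sb.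
  have ax := side_neq tt tzx sa; have bx := side_neq tt tzx sb.
  apply: connect1; rewrite /s2 /exchange /add_edge /del_edge; apply/orP; left.
  rewrite /s1 /exchange /add_edge /del_edge tab /same_edge (negbTE ax) (negbTE bx).
  by rewrite !andbF.
have [ts2 ds2] := tree_exchange ts1 s1xw zw cs2.
have s2e : subrel s2 e by apply: subrel_exchange.
rewrite -/s2 in ts2 ds2; clearbody s2; clearbody s1.
have ds y : deg s2 y + (y == x) = deg t y + (y == u).
  by have := ds1 y; have := ds2 y; clear; lia.
have [d3|d2] := ltnP 2 (deg t x).
  apply: (min_leaves_contra ot ts2 s2e Lu) => y; rewrite !mem_leaves; have := ds y.
  move: Lu; rewrite mem_leaves => /eqP Lu.
  have [->|yx] := eqVneq y x.
    by rewrite eq_sym (negbTE ux); move: d3; clear; lia.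
  have [->|yu] := eqVneq y u; first by rewrite Lu; clear; lia.
  by rewrite !addn0 => ->.
case: alt => [|[v [Lv vu evx]]]; first by rewrite ltnNge d2.
have os2 : min_leaves s2.
  apply: (@min_leaves_replace t s2 u x) => // y; rewrite !mem_leaves; have := ds y.
  have [->|yx] := eqVneq y x; first by left.
  move: Lu; rewrite mem_leaves => /eqP Lu.
  have [->|yu] := eqVneq y u; first by rewrite Lu; clear; lia.
  by rewrite !addn0 => ->; right.
have vx : v != x by apply: contraTneq evx => ->; rewrite ei.
suff: ~~ e v x by rewrite evx.
apply: (min_leaves_indep os2); rewrite mem_leaves.
  by have := ds v; rewrite (negbTE vx) (negbTE vu) !addn0 => ->; rewrite -mem_leaves.
by have := ds x; rewrite eqxx eq_sym (negbTE ux); move: d2 dx; clear; lia.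
Qed.

Lemma other_nbr t x z : t x z -> 1 < deg t x -> exists2 w, t x w & w != z.
Proof.
move=> txz dx; have [|w' txw] := @nbr_notin _ t [:: z] x; first exact: dx.
by rewrite inE => wz; exists w'.
Qed.

(** Otherwise [u], [v], [z] and another neighbour [w] of [x] would be the ends of an induced K_{1,4}
    centred at [x]. *)
Lemma chord_uniq t z x u v : min_leaves t -> chord t z x u -> chord t z x v -> u = v.
Proof.
move=> ot ou ov; apply: contraTeq isT => uv; apply/negP => _.
have [tt te _] := ot; have dx := chord_head ot ou.
have [tzx Lu su eux] := chordP _ _ _ _ ou; have [_ Lv sv evx] := chordP _ _ _ _ ov.
have txz : t x z by rewrite (tree_sym tt).
have [w txw wz] := other_nbr txz dx.
have zw : z != w by rewrite eq_sym.
have zu : z != u.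
  apply: contraNneq uv => zu; rewrite zu in Lu tzx sv.
  by rewrite (side_leaf tt Lu tzx sv).
have zv : z != v.
  apply: contraNneq uv => zv; rewrite zv in Lv tzx su.
  by rewrite (side_leaf tt Lv tzx su).
have uw := side_nbr_neq tt tzx txw zw su.
have vw := side_nbr_neq tt tzx txw zw sv.
have vu : v != u by rewrite eq_sym.
have exu : e x u by rewrite es.
have exv : e x v by rewrite es.
apply: (K14_edge exu exv (te _ _ txz) (te _ _ txw)).
  by rewrite /= !inE !negb_or uv uw vw zw andbT ![_ == z]eq_sym zu zv.
rewrite (negbTE (min_leaves_indep ot Lu Lv)) es (negbTE (chord_tail_nonadj ot ov Lu uv)).
rewrite (es v z) (negbTE (chord_tail_nonadj ot ou Lv vu)).
rewrite (negbTE (chord_nbr_nonadj ot ou txw wz _)); last by right; exists v.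
rewrite orbF /=; apply/norP; split; apply/negP => ew.
  (* If [uw] is an edge, then [u] is attached to the dart [(x,w)] as well, so the tail [x] cannot be
     adjacent to the other leaf [v]. *)
  have owu : chord t x w u by apply/chordP; split => //; apply: side_nest su.
  by have := chord_tail_nonadj ot owu Lv vu; rewrite es evx.
have owv : chord t x w v by apply/chordP; split; rewrite ?orbF // in ew *; apply: side_nest sv.
by have := chord_tail_nonadj ot owv Lu uv; rewrite es eux.
Qed.

Definition chorded t z x := [exists u, chord t z x u].

(** Leaves attached to opposite darts lie on different sides, hence differ; but [z] is adjacent to
    no leaf other than [u]. *)
Lemma chorded_rev t z x : min_leaves t -> chorded t z x -> ~~ chorded t x z.
Proof.
move=> ot /existsP[u ou]; apply/negP => /existsP[v ov].
have [tt te _] := ot.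
have [tzx Lu su eux] := chordP _ _ _ _ ou; have [_ Lv sv evz] := chordP _ _ _ _ ov.
have vu : v != u.
  by apply: contraTneq sv => ->; rewrite sideN // negbK.
by have := chord_tail_nonadj ot ou Lv vu; rewrite es evz.
Qed.

(** * Chords that end at a branch vertex *)

(** An edge [uw] would attach [u] to the dart [(b,w)], whose tail is a branch vertex, against
    [chord_tail]. *)
Lemma branch_nbr_nonadj t z b u w : min_leaves t -> chord t z b u -> 2 < deg t b ->
  t b w -> w != z -> ~~ e u w.
Proof.
move=> ot ou db tbw wz; apply/negP => euw.
have [tt te _] := ot; have [tzb Lu su eub] := chordP _ _ _ _ ou.
have : chord t b w u.
  by apply/chordP; split => //; apply: side_nest su => //; rewrite eq_sym.
by move/(chord_tail ot); rewrite leqNgt db.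
Qed.

(** Otherwise [u], [z], [w], [w'] would be the ends of an induced K_{1,4} centred at [b]. *)
Lemma free_nbrs_adj t z b u w w' : min_leaves t -> chord t z b u -> 2 < deg t b ->
  ~~ e u z -> z != u ->
  t b w -> w != z -> t b w' -> w' != z -> w != w' -> e w w'.
Proof.
move=> ot ou db euz zu tw wz tw' wz' ww'; apply: contraTT isT => eww'; exfalso.
have [tt te _] := ot; have [tzb Lu su eub] := chordP _ _ _ _ ou.
have tbz : t b z by rewrite (tree_sym tt).
have zw : z != w by rewrite eq_sym.
have zw' : z != w' by rewrite eq_sym.
have ebu : e b u by rewrite es.
apply: (K14_edge ebu (te _ _ tbz) (te _ _ tw) (te _ _ tw')).
  rewrite /= !inE !negb_or ww' zw zw' eq_sym zu.
  by rewrite (side_nbr_neq tt tzb tw zw su) (side_nbr_neq tt tzb tw' zw' su).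
rewrite (negbTE euz) (negbTE eww').
rewrite (negbTE (branch_nbr_nonadj ot ou db tw wz)).
rewrite (negbTE (branch_nbr_nonadj ot ou db tw' wz')).
rewrite (negbTE (chord_nbr_nonadj ot ou tw wz _)); last by left.
by rewrite (negbTE (chord_nbr_nonadj ot ou tw' wz' _)); last by left.
Qed.

(** If a leaf [v] were attached to [(w,b)], then [u], [v], [z] and a third neighbour [w'] of [b]
    would be the ends of an induced K_{1,4}. *)
Lemma free_nbr_in t z b u w : min_leaves t -> chord t z b u -> 2 < deg t b ->
  ~~ e u z -> z != u -> t b w -> w != z -> ~~ chorded t w b.
Proof.
move=> ot ou db euz zu tw wz; apply/negP => /existsP[v ov].
have [tt te _] := ot; have [tzb Lu su eub] := chordP _ _ _ _ ou.
have [twb Lv sv evb] := chordP _ _ _ _ ov.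
have st := tree_sym tt; have dz := chord_tail2 ot ou zu.
have [w' tw'] := @nbr_notin _ t [:: z; w] b db; rewrite !inE negb_or => /andP[wz' ww'].
have tbz : t b z by rewrite st.
have zw' : z != w' by rewrite eq_sym.
have w'w : w != w' by rewrite eq_sym.
have uv : u != v.
  apply: contraNneq wz => uv; rewrite -uv in sv.
  by rewrite (toward_uniq tt tbz tw su sv).
have vu : v != u by rewrite eq_sym.
have zv : z != v by apply: contraTneq Lv => <-; rewrite mem_leaves dz.
have ebu : e b u by rewrite es.
have ebv : e b v by rewrite es.
apply: (K14_edge ebu ebv (te _ _ tbz) (te _ _ tw')).
  rewrite /= !inE !negb_or uv zw' (eq_sym u z) zu (eq_sym v z) zv.
  by rewrite (side_nbr_neq tt tzb tw' zw' su) (side_nbr_neq tt twb tw' w'w sv).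
rewrite (negbTE (min_leaves_indep ot Lu Lv)) (negbTE euz).
rewrite (negbTE (branch_nbr_nonadj ot ou db tw' wz')).
rewrite (es v z) (negbTE (chord_tail_nonadj ot ou Lv vu)).
rewrite (negbTE (branch_nbr_nonadj ot ov db tw' ww')).
by rewrite (negbTE (chord_nbr_nonadj ot ou tw' wz' _)); last by left.
Qed.

(** The new edge [ww'] is supplied by [free_nbrs_adj]. Only [b] loses degree and it keeps at least
    2, so no leaf is created; if [w] were a leaf, one would be saved. *)
Lemma slide_min t z b u w w' (s := exchange t b w' w' w) :
  min_leaves t -> chord t z b u -> 2 < deg t b ->
  ~~ e u z -> z != u -> t b w -> w != z -> t b w' -> w' != z -> w != w' ->
  [/\ min_leaves s, 1 < deg t w, leaves s =i leaves t &
      forall y, deg s y + (y == b) = deg t y + (y == w)].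
Proof.
move=> ot ou db euz zu tw wz tw' wz' ww'.
have [tt te _] := ot; have [ts ds] := slide_tree tt tw tw' ww'.
have bw := tree_edge_neq tt tw.
have se : subrel s e.
  by apply: subrel_exchange => //; rewrite es (free_nbrs_adj ot ou db euz zu tw wz tw' wz' ww').
rewrite -/s in ts ds; clearbody s.
have dw : 1 < deg t w.
  have := min_leaves_deg_gt0 w ot; rewrite leq_eqVlt => /predU1P[dw|//].
  have Lw : w \in leaves t by rewrite mem_leaves -dw.
  exfalso; apply: (min_leaves_contra ot ts se Lw) => y; rewrite !mem_leaves; have := ds y.
  have [->|yb] := eqVneq y b; first by case: (b == w); move: db; clear; lia.
  have [->|yw] := eqVneq y w; first by rewrite -dw; clear; lia.
  by rewrite !addn0 => ->.
have ls : leaves s =i leaves t.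
  move=> y; rewrite !mem_leaves; have := ds y.
  have [->|yb] := eqVneq y b; first by rewrite (negbTE bw); move: db; clear; lia.
  have [->|yw] := eqVneq y w; first by move: dw; clear; lia.
  by rewrite !addn0 => ->.
split => //; apply: (min_leaves_subset ot ts se).
by apply/subsetP => y; rewrite ls.
Qed.

(** A chord for [(w,y)] would survive a slide along [bw], which raises the degree of its tail [w] to
    at least 3. *)
Lemma free_nbr_out t z b u w y : min_leaves t -> chord t z b u -> 2 < deg t b ->
  ~~ e u z -> z != u -> t b w -> w != z -> t w y -> y != b -> ~~ chorded t w y.
Proof.
move=> ot ou db euz zu tw wz twy yb; apply/negP => /existsP[v ov].
have [tt te _] := ot; have [_ Lv sv evy] := chordP _ _ _ _ ov.
have [w' tw'] := @nbr_notin _ t [:: z; w] b db; rewrite !inE negb_or => /andP[wz' ww'].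
have w'w : w != w' by rewrite eq_sym.
have [os dw ls ds] := slide_min ot ou db euz zu tw wz tw' wz' w'w.
have bw := tree_edge_neq tt tw.
have yw' : y != w'.
  by apply/eqP => yw'; apply: (no_triangle tt tw twy); rewrite yw'.
have : chord (exchange t b w' w' w) w y v.
  apply/chordP; split; rewrite ?ls //.
    apply: slide_edge => //; apply/same_edgeP.
    by case=> [[/eqP]|[/eqP]]; rewrite ?(negbTE w'w) // eq_sym (negbTE bw).
  apply: slide_side => //; apply/same_edgeP.
    by case=> [[/eqP]|[/eqP + _]]; rewrite ?(negbTE bw) // eq_sym (negbTE yb).
  by case=> [[_ /eqP]|[/eqP + _]]; rewrite ?(negbTE (tree_edge_neq tt twy)) // eq_sym
    (negbTE yw').
move/(chord_tail os); have := ds w; rewrite eqxx eq_sym (negbTE bw).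
by move: dw; clear; lia.
Qed.

Definition min_leaves_branches t := min_leaves t /\
  forall s, min_leaves s -> #|branch_vertices t| <= #|branch_vertices s|.

(** Otherwise all neighbours of [b] except [z] are branch vertices. Slides at [b] then create no
    branch vertex and lower the degree of [b] until it stops being one, against the choice of
    [t]. *)
Lemma free_nbr_deg2 t z b u : min_leaves_branches t -> chord t z b u -> 2 < deg t b ->
  ~~ e u z -> z != u -> exists w, [/\ t b w, w != z & deg t w = 2].
Proof.
move=> o2 ou db euz zu; apply: NNPP => no.
have big w : t b w -> w != z -> 2 < deg t w.
  move=> tw wz; have [ot _] := o2.
  have [w' tw'] := @nbr_notin _ t [:: z; w] b db; rewrite !inE negb_or => /andP[wz' ww'].
  have w'w : w != w' by rewrite eq_sym.
  have [_ dw _ _] := slide_min ot ou db euz zu tw wz tw' wz' w'w.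
  rewrite ltn_neqAle dw andbT; apply/eqP => d2; apply: no; by exists w.
have [m] := ubnP (deg t b); elim: m t o2 ou db {no} big => // m IH t o2 ou db big.
rewrite ltnS => dm; have [ot mb] := o2; have [tt te _] := ot.
have [tzb Lu su eub] := chordP _ _ _ _ ou.
have [w tw] := @nbr_notin _ t [:: z] b (ltnW db); rewrite inE => wz.
have [w' tw'] := @nbr_notin _ t [:: z; w] b db; rewrite !inE negb_or => /andP[wz' ww'].
have w'w : w != w' by rewrite eq_sym.
have [os _ ls ds] := slide_min ot ou db euz zu tw wz tw' wz' w'w.
have bw := tree_edge_neq tt tw; have bw' := tree_edge_neq tt tw'.
have bz : b != z by rewrite eq_sym (tree_edge_neq tt tzb).
pose s := exchange t b w' w' w; rewrite -/s in os ls ds.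
have bs : branch_vertices s \subset branch_vertices t.
  apply/subsetP => y; rewrite !inE; have := ds y.
  have [->|yb] := eqVneq y b; first by rewrite db.
  have [->|yw] := eqVneq y w; first by rewrite big.
  by rewrite !addn0 => ->.
have db1 : deg s b + 1 = deg t b by have := ds b; rewrite eqxx (negbTE bw) addn0.
(* At degree 3 a single slide removes [b] from the branch vertices; above that, the slid tree meets
   the same hypotheses with a smaller degree at [b]. *)
have [d3|d3] := leqP (deg t b) 3.
  have : branch_vertices s \subset branch_vertices t :\ b.
    rewrite subsetD1 bs inE -leqNgt; move: db1 d3; clear; lia.
  move=> /subset_leq_card; have := mb _ os.
  by rewrite (cardsD1 b (branch_vertices t)) inE db; clear; lia.
apply: (IH s).
- by split => // r or; apply: leq_trans (subset_leq_card bs) (mb r or).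
- apply/chordP; split; rewrite ?ls //.
    apply: slide_edge => //; apply/same_edgeP.
    by case=> [[/eqP]|[/eqP]]; rewrite eq_sym ?(negbTE bz) // (negbTE wz').
  apply: slide_side => //; apply/same_edgeP.
    by case=> [[/eqP]|[_ /eqP]]; rewrite ?(negbTE bz) ?(negbTE wz).
  by case=> [[/eqP]|[/eqP]]; rewrite ?(negbTE wz) // eq_sym (negbTE bw).
- by move: db1 d3; clear; lia.
- move=> y /orP[/andP[ty _] yz|/same_edgeP[[/eqP]|[/eqP]]].
  + have := big y ty yz; have := ds y.
    rewrite [y == b]eq_sym (negbTE (tree_edge_neq tt ty)).
    by case: (y == w); clear; lia.
  + by rewrite (negbTE bw').
  + by rewrite (negbTE bw).
- by move: db1 dm; clear; lia.
Qed.

(** * Runs into a branch vertex *)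

(* The path from [z] through [x] enters the branch vertex [b] through [a], without
   passing a branch vertex before, and the leaf [u] behind [z] is adjacent to [a] and [b]. *)
Definition run t z x := exists u a b,
  [/\ [/\ chord t a b u, 2 < deg t b & e u a], side t z x u, side t a b z,
      (forall v, v \in leaves t -> side t x z v -> side t b a v) &
      a = z /\ b = x \/ side t x z a].

Lemma run_start t z b u : chord t z b u -> 2 < deg t b -> e u z -> run t z b.
Proof.
move=> ou db euz; exists u, z, b; have [tzb Lu su eub] := chordP _ _ _ _ ou.
by split => //; [exact: side_refl | left].
Qed.

Lemma side_other t x y z c : tree t -> deg t z = 2 -> t z x -> t z y -> x != y ->
  side t z x c -> c != z -> side t y z c.
Proof.
move=> tt dz zx zy xy sc cz; have [d [zd dx sd]] := side_step tt zx sc cz.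
have := @nbr_in _ t [:: x; y] z d; rewrite /= !inE xy zx zy dz => /(_ isT isT erefl zd).
by rewrite (negbTE dx) /= => /eqP dy; rewrite -dy.
Qed.

Lemma run_prev t z x y : min_leaves t -> t z x -> deg t z = 2 -> t z y -> x != y ->
  run t z x -> run t y z.
Proof.
move=> [tt _ _] zx dz zy xy [u [a [b [[ou db eua] su sab sl ab]]]].
have st := tree_sym tt; have [tab Lu _ _] := chordP _ _ _ _ ou.
have uz : u != z by apply: contraTneq Lu => ->; rewrite mem_leaves dz.
have xz : t x z by rewrite st.
exists u, a, b; split => //.
- exact: side_other zx zy xy su uz.
- apply: (side_edge zy _ sab); apply/same_edgeP.
  case=> [[za yb]|[zb _]]; last first.
    by move: sab; rewrite zb; apply/negP; apply: side_notin.
  case: ab => [[_ bx]|sa]; first by move: xy; rewrite -bx yb eqxx.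
  by move: sa; rewrite -za; apply/negP; apply: side_notin.
- move=> v Lv sv; have vz : v != z by apply: contraTneq Lv => ->; rewrite mem_leaves dz.
  by apply: sl => //; apply: (side_other tt dz zy zx) => //; rewrite eq_sym.
- case: ab => [[-> _]|sa]; right; first exact: side_refl.
  exact: side_nest sa.
Qed.

(** A leaf [v] attached to [(z,y)] lies beyond [x], hence beyond [b], and differs from [u]. If
    [a = z], the tail of this dart is adjacent to the second leaf [u]; otherwise [zy] is exchanged
    for [vy]. *)
Lemma run_two t z x y : min_leaves t -> t z x -> deg t z = 2 -> t z y -> x != y ->
  run t z x -> ~~ chorded t z y.
Proof.
move=> ot zx dz zy xy [u [a [b [[ou db eua] su sab sl ab]]]].
apply/negP => /existsP[v ov]; have [tt te _] := ot; have st := tree_sym tt.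
have [tab Lu sabu eub] := chordP _ _ _ _ ou; have [_ Lv sv evy] := chordP _ _ _ _ ov.
have vz : v != z by apply: contraTneq Lv => ->; rewrite mem_leaves dz.
have uz : u != z by apply: contraTneq Lu => ->; rewrite mem_leaves dz.
have xz : t x z by rewrite st.
have yx : y != x by rewrite eq_sym.
have sxv : side t x z v := side_other tt dz zy zx yx sv vz.
have uv : u != v by apply: contraTneq sxv => <-; rewrite sideN // su.
have [az|az] := eqVneq a z.
  by have := chord_tail_nonadj ot ov Lu uv; rewrite -az es eua.
have {ab} sa : side t x z a by case: ab => [[/eqP]|//]; rewrite (negbTE az).
have [ts se ds] := chord_exchange_tree ot ov; have os := chord_exchange_min ot ov.
pose s := exchange t z y v y; rewrite -/s in ts se ds os.
have syz : t y z by rewrite st.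
have sya : side t z y a := side_nest tt xz zy xy sa.
have tba : t b a by rewrite st.
have bz : b != z by apply: contraTneq db => ->; rewrite dz.
have bva := sl v Lv sxv.
have va : v != a := side_neq tt tba bva.
have ba : b != a := tree_edge_neq tt tba.
have vb : v != b by apply: contraTneq db => <-; move: Lv; rewrite mem_leaves => /eqP->.
have sval : s v y by rewrite /s /exchange /add_edge /same_edge !eqxx orbT.
have keep p q : t p q -> ~~ same_edge z y p q -> s p q.
  by move=> tpq ne; rewrite /s /exchange /add_edge /del_edge tpq ne.
(* In [s] the vertex [b] reaches [u] through [v] and [y] without the edge [ba], so [u] is attached
   to a dart whose tail is a branch vertex. *)
suff ow : chord s b a u.
  have := chord_tail os ow; have := ds b; rewrite (negbTE bz).
  by move: db; clear; lia.
apply/chordP; split.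
- apply: keep => //; apply/same_edgeP => -[[/eqP]|[_ /eqP]]; first by rewrite (negbTE bz).
  by rewrite (negbTE az).
- have := ds u; rewrite mem_leaves (negbTE uz) (negbTE uv) !addn0 => ->.
  by rewrite -mem_leaves.
- have sds : symmetric (del_edge s b a) by apply/del_edge_sym/tree_sym.
  apply: (@connect_trans _ _ v).
    apply: side_connect bva => p q tpq sp sq; apply: connect1; rewrite /del_edge.
    have pa := side_neq tt tba sp; have qa := side_neq tt tba sq.
    rewrite [same_edge b a p q]/same_edge (negbTE pa) (negbTE qa) !andbF andbT.
    apply: keep => //; apply/same_edgeP; have nz : ~~ side t b a z by rewrite sideN // sab.
    case=> [[pz _]|[_ qz]]; move/negP: nz; apply; first by rewrite -pz.
    by rewrite -qz.
  apply: (@connect_trans _ _ y).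
    apply: connect1; rewrite /del_edge sval /=; apply/same_edgeP.
    by case=> [[/eqP]|[/eqP]]; rewrite ?(negbTE va) ?(negbTE vb).
  have syu : side t y z u := side_other tt dz zx zy xy su uz.
  apply: side_connect syu => p q tpq sp sq; apply: connect1; rewrite /del_edge.
  have nay : ~~ side t y z a by rewrite sideN // sya.
  have pz := side_neq tt syz sp; have qz := side_neq tt syz sq.
  rewrite keep //=; last by rewrite /same_edge (negbTE pz) (negbTE qz) andbF.
  apply/same_edgeP; case=> [[_ qa]|[pa _]]; move/negP: nay; apply; first by rewrite -qa.
  by rewrite -pa.
- by [].
Qed.

(** * Counting darts *)

Section Count.
Variable t : rel V.
Hypothesis o2 : min_leaves_branches t.

Let ot : min_leaves t. Proof. by case: o2. Qed.
Let tt : tree t. Proof. by case: ot. Qed.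
Let st : symmetric t. Proof. exact: tree_sym. Qed.

(** Meant for [z] of degree 2 with neighbour [x], where the default value is never taken. *)
Definition next_nbr z x := odflt z [pick y | t z y && (y != x)].

Lemma next_nbrP z x : t z x -> deg t z = 2 ->
  [/\ t z (next_nbr z x), x != next_nbr z x & forall y, t z y -> y != x -> y = next_nbr z x].
Proof.
move=> zx dz; rewrite /next_nbr; case: pickP => [y /andP[zy yx]|no] /=.
  split; rewrite // 1?eq_sym // => w zw wx.
  have := @nbr_in _ t [:: x; y] z w; rewrite /= !inE eq_sym yx zx zy dz.
  by move=> /(_ isT isT erefl zw); rewrite (negbTE wx) /= => /eqP.
have [|w zw wx] := other_nbr zx _; first by rewrite dz.
by have := no w; rewrite zw wx.
Qed.

Definition rev_dart (d : V * V) := (d.2, d.1).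
Definition prev_dart (d : V * V) := (next_nbr d.1 d.2, d.1).
Definition deg2_darts := [set d : V * V | t d.1 d.2 && (deg t d.1 == 2)].
Definition chorded_darts := [set d in deg2_darts | chorded t d.1 d.2].
Definition branch_darts := [set d in chorded_darts | 2 < deg t d.2].
Definition free (d : V * V) := [exists u, chord t d.1 d.2 u && ~~ e u d.1].
Definition free_darts := [set d in branch_darts | free d].
Definition tied_darts := [set d in branch_darts | ~~ free d].
Definition step d d' := (d' == prev_dart d) && (d' \in chorded_darts).
Definition run_darts := [set d | [exists d0 in tied_darts, connect step d0 d]].
Definition run_inner := [set d in run_darts | prev_dart d \in chorded_darts].
Definition rev_chorded := [set d | rev_dart d \in chorded_darts].

Lemma deg2_dartsP d : reflect (t d.1 d.2 /\ deg t d.1 = 2) (d \in deg2_darts).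
Proof. by rewrite inE; apply: (iffP andP) => -[? /eqP]. Qed.

Lemma chorded_dartsP d : reflect [/\ t d.1 d.2, deg t d.1 = 2 & chorded t d.1 d.2] (d \in chorded_darts).
Proof.
rewrite inE; apply: (iffP andP) => [[/deg2_dartsP[]]|[? ? ?]] //.
by split => //; apply/deg2_dartsP.
Qed.

Lemma run_darts_run d : d \in run_darts -> d \in chorded_darts /\ run t d.1 d.2.
Proof.
rewrite inE => /exists_inP[d0 d0B]; move: d; apply: connect_closed_ind.
  move: d0B; rewrite inE => /andP[]; rewrite inE => /andP[dG db] /existsPn nb0.
  split => //; case/chorded_dartsP: dG => _ _ /existsP[u ou]; have := nb0 u; rewrite ou negbK => euz.
  exact: run_start ou db euz.
move=> d d' _ /andP[/eqP-> pG] [/chorded_dartsP[zx dz _] rd]; split => //.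
have [zy xy _] := next_nbrP zx dz; exact: run_prev rd.
Qed.

Lemma prev_dart_inj : {in deg2_darts &, injective prev_dart}.
Proof.
move=> [z x] [z' x'] /deg2_dartsP[/= zx dz] /deg2_dartsP[/= zx' _] [nn zz].
rewrite -{}zz in nn zx' *; congr pair.
have [_ _ un] := next_nbrP zx dz; have [_ xy _] := next_nbrP zx' dz.
by apply/eqP; apply: contraNT xy => xx'; rewrite -nn; apply/eqP/un; rewrite // eq_sym.
Qed.

Lemma chorded_deg2 d : d \in chorded_darts -> d \in deg2_darts. Proof. by rewrite inE => /andP[]. Qed.

(** [prev_dart] maps [run_inner] injectively into [run_darts] and misses the tied darts, whose heads
    are branch vertices while its values have heads of degree 2. This count replaces following each
    path to its end. *)
Lemma card_tied_darts : #|tied_darts| <= #|run_darts :\: run_inner|.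
Proof.
have CQ : run_inner \subset run_darts by apply/subsetP => d; rewrite inE => /andP[].
have := cardsID run_inner run_darts; rewrite (setIidPr CQ) => Qc.
rewrite -(leq_add2l #|run_inner|) Qc.
have -> : #|run_inner| = #|prev_dart @: run_inner|.
  rewrite card_in_imset // => d d' /(subsetP CQ)/run_darts_run[/chorded_deg2 dD _].
  by move=> /(subsetP CQ)/run_darts_run[/chorded_deg2 dD' _]; apply: prev_dart_inj.
have dis : prev_dart @: run_inner :&: tied_darts = set0.
  apply/setP => d; rewrite in_set0; apply/negP => /setIP[/imsetP[d0 d0C ->]].
  rewrite !inE /= => /andP[/andP[_ db] _].
  have [/chorded_dartsP[_ dz _] _] := run_darts_run (subsetP CQ _ d0C).
  by rewrite dz in db.
rewrite -cardsUI dis cards0 addn0; apply: subset_leq_card; rewrite subUset.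
apply/andP; split; apply/subsetP => d.
  move=> /imsetP[d0]; rewrite inE => /andP[d0Q pG] ->.
  move: d0Q; rewrite !inE => /exists_inP[d1 d1B c1]; apply/exists_inP; exists d1 => //.
  by apply: connect_trans c1 (connect1 _); rewrite /step eqxx.
by move=> dB; rewrite inE; apply/exists_inP; exists d => //; apply: connect0.
Qed.

(** On free darts [free_nbr_deg2] rules out the default value. *)
Definition free_target (d : V * V) :=
  (odflt d.1 [pick w | [&& t d.2 w, w != d.1 & deg t w == 2]], d.2).
Definition run_target (d : V * V) := (d.1, next_nbr d.1 d.2).

Lemma free_dartsP d : d \in free_darts -> exists u,
  [/\ chord t d.1 d.2 u, 2 < deg t d.2, ~~ e u d.1, d.1 != u & d \in chorded_darts].
Proof.
rewrite inE => /andP[]; rewrite inE => /andP[dG db] /existsP[u /andP[ou eu]].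
exists u; split => //; have /chorded_dartsP[_ dz _] := dG; have [_ Lu _ _] := chordP _ _ _ _ ou.
by apply: contraTneq Lu => <-; rewrite mem_leaves dz.
Qed.

Lemma free_targetP d : d \in free_darts -> exists w,
  [/\ free_target d = (w, d.2), t d.2 w, w != d.1 & deg t w = 2].
Proof.
move=> /free_dartsP[u [ou db eu zu _]]; rewrite /free_target.
case: pickP => [w /and3P[tw wz /eqP dw]|no].
  by exists w.
have [w [tw wz dw]] := free_nbr_deg2 o2 ou db eu zu.
by have := no w; rewrite tw wz dw.
Qed.

(* The right-hand side consists of the darts [(p,q)] with [p] of degree 2 such that neither
   [(p,q)] nor [(q,p)] is in [chorded_darts]. *)
Lemma card_branch_darts : #|branch_darts| <= #|(deg2_darts :\: chorded_darts) :\: rev_chorded|.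
Proof.
have -> : #|branch_darts| = #|free_darts| + #|tied_darts|.
  rewrite -(cardsID [set d | free d] branch_darts); congr (_ + _); apply: eq_card => d.
    by rewrite in_setI [in RHS]inE [in LHS]inE.
  by rewrite in_setD [in RHS]inE [in LHS]inE andbC.
apply: leq_trans (leq_add (leqnn _) card_tied_darts) _.
(* By [free_nbr_in] no other chorded dart shares the head of a free dart, so the head determines the
   dart. *)
have i1 : {in free_darts &, injective free_target}.
  move=> d d' dB dB'; have [u [ou db eu zu dG]] := free_dartsP dB.
  have [w [-> tw wz _]] := free_targetP dB; have [w' [-> _ _ _]] := free_targetP dB'.
  case=> _ bb; have [u' [_ _ _ _ /chorded_dartsP[tz' _ gd']]] := free_dartsP dB'.
  case: d d' {dB dB' dG} ou db eu zu tw wz bb tz' gd' => [z b] [z' b'] /= ou db eu zu tw wz bb tz' gd'.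
  rewrite -{}bb in tz' gd' *; congr pair; apply/eqP; rewrite eq_sym; apply: contraTT gd' => zz'.
  by apply: (free_nbr_in ot ou) => //; rewrite st.
have i2 : {in run_darts :\: run_inner &, injective run_target}.
  move=> [z x] [z' x'] /setDP[/run_darts_run[/chorded_dartsP[/= zx dz _] _] _].
  move=> /setDP[/run_darts_run[/chorded_dartsP[/= zx' _ _] _] _] [zz nn].
  rewrite -{}zz in zx' nn *.
  by apply: prev_dart_inj; [apply/deg2_dartsP|apply/deg2_dartsP|rewrite /prev_dart /= nn].
rewrite -(card_in_imset i1) -(card_in_imset i2) -cardsUI.
(* A common target [(w,b)] would stem from a chorded dart with tail [w] and head other than [b],
   against [free_nbr_out]. *)
have -> : free_target @: free_darts :&: run_target @: (run_darts :\: run_inner) = set0.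
  apply/setP => d; rewrite in_set0; apply/negP => /setIP[/imsetP[d1 d1B ->]].
  have [w [-> tw wz dw]] := free_targetP d1B; case/imsetP=> [[z x] /setDP[dQ _] [wz' bn]].
  have [u [ou db eu zu dG]] := free_dartsP d1B.
  have [/chorded_dartsP[/= zx dz gd] _] := run_darts_run dQ; have [_ xy _] := next_nbrP zx dz.
  move: gd; rewrite -wz'; apply/negP; apply: (free_nbr_out ot ou) => //.
    by rewrite wz'.
  by rewrite bn.
rewrite cards0 addn0; apply: subset_leq_card; rewrite subUset.
apply/andP; split; apply/subsetP => d /imsetP[d1].
  move=> d1B ->; have [w [-> tw wz dw]] := free_targetP d1B.
  have [u [ou db eu zu dG]] := free_dartsP d1B.
  have ng : ~~ chorded t w d1.2 by apply: (free_nbr_in ot ou).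
  rewrite !in_setD; apply/and3P; split.
  - by rewrite inE; apply/negP => /chorded_dartsP[/= _ db2 _]; rewrite db2 in db.
  - by apply/negP => /chorded_dartsP[/= _ _]; apply/negP.
  - by apply/deg2_dartsP; rewrite /= st.
move=> /setDP[dQ nC] ->; have [/chorded_dartsP[zx dz gd] rd] := run_darts_run dQ.
have [zy xy _] := next_nbrP zx dz.
rewrite !in_setD; apply/and3P; split; last exact/deg2_dartsP.
- by move: nC; rewrite [d1 \in run_inner]inE dQ [run_target d1 \in rev_chorded]inE.
- by apply/negP => /chorded_dartsP[/= _ _]; apply/negP; apply: run_two rd.
Qed.

(** Reversal sends the chorded darts with head of degree 2 to unchorded darts inside [rev_chorded];
    the partners from [card_branch_darts] lie outside it, so none is used twice. *)
Lemma card_chorded_darts : 2 * #|chorded_darts| <= #|deg2_darts|.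
Proof.
have GsD : chorded_darts \subset deg2_darts by apply/subsetP => d; apply: chorded_deg2.
have HsG : branch_darts \subset chorded_darts by apply/subsetP => d; rewrite inE => /andP[].
have := cardsID chorded_darts deg2_darts; rewrite (setIidPr GsD).
have := cardsID rev_chorded (deg2_darts :\: chorded_darts); have := card_branch_darts.
have := cardsID branch_darts chorded_darts; rewrite (setIidPr HsG).
suff : #|chorded_darts :\: branch_darts| <=
    #|(deg2_darts :\: chorded_darts) :&: rev_chorded| by clear; lia.
have ri : injective rev_dart by move=> [a b] [c d] [-> ->].
rewrite -(card_imset _ ri); apply: subset_leq_card; apply/subsetP => d /imsetP[[z x]].
case/setDP=> dG nH ->; have /chorded_dartsP[/= zx dz gd] := dG.
have dx : deg t x = 2.
  move: nH; rewrite inE dG -leqNgt /= => dx; apply/eqP; rewrite eqn_leq dx.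
  by case/existsP: gd => u ou; apply: chord_head ou.
rewrite in_setI in_setD [_ \in rev_chorded]inE /rev_dart dG andbT; apply/andP; split.
  by apply/negP => /chorded_dartsP[/= _ _]; apply/negP; apply: chorded_rev.
by apply/deg2_dartsP; rewrite /= st.
Qed.

Lemma card_darts (r : rel V) :
  #|[set d : V * V | r d.1 d.2]| = \sum_z #|[set x | r z x]|.
Proof.
under eq_bigr => z _ do rewrite -sum1dep_card.
by rewrite pair_big_dep /= sum1dep_card.
Qed.

Lemma card_darts_deg k :
  #|[set d : V * V | t d.1 d.2 && (deg t d.1 == k)]| = k * #|[set z | deg t z == k]|.
Proof.
rewrite (card_darts (fun z x => t z x && (deg t z == k))) card_set_sum big_distrr /=.
apply: eq_bigr => z _; rewrite inE; case: eqP => [dz|_].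
  by rewrite muln1 -[RHS]dz; apply: eq_card => x; rewrite !inE andbT.
by rewrite muln0; apply: eq_card0 => x; rewrite !inE andbF.
Qed.

(** Sending an edge at a leaf to the dart it is attached to is injective by [chord_uniq]. Tails of
    degree 1 contribute at most one dart each, and at most half of the darts with tails of degree 2
    occur, so the sum is at most the number of vertices of degree 1 or 2. *)
Lemma sum_leaf_deg : \sum_(u in leaves t) deg e u + #|branch_vertices t| <= #|V|.
Proof.
pose E := [set d : V * V | (d.1 \in leaves t) && e d.1 d.2].
have -> : \sum_(u in leaves t) deg e u = #|E|.
  rewrite (card_darts (fun u x => (u \in leaves t) && e u x)) big_mkcond.
  apply: eq_bigr => u _; case: (u \in leaves t) => /=; first by [].
  by apply/esym/eq_card0 => x; rewrite !inE.
pose f (d : V * V) := (odflt d.2 [pick z | chord t z d.2 d.1], d.2).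
have fP u x : (u, x) \in E -> exists2 z, f (u, x) = (z, x) & chord t z x u.
  rewrite inE /= => /andP[Lu eux]; rewrite /f /=; case: pickP => [z oz|no]; first by exists z.
  have [|z xz sz] := toward tt (x := x) (r := u).
    by apply: contraTneq eux => ->; rewrite ei.
  by have := no z; rewrite /chord Lu sz eux st xz.
have fi : {in E &, injective f}.
  move=> [u x] [u' x'] /fP[z -> ou] /fP[z' -> ou'] [zz xx]; congr pair => //.
  by rewrite -zz -xx in ou'; apply: chord_uniq ou ou'.
have : #|E| <= #|[set d : V * V | t d.1 d.2 && (deg t d.1 == 1)] :|: chorded_darts|.
  rewrite -(card_in_imset fi); apply: subset_leq_card; apply/subsetP => d.
  case/imsetP=> [[u x] /fP[z -> ou] ->]; have [zx _ _ _] := chordP _ _ _ _ ou.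
  have gd : chorded t z x by apply/existsP; exists u.
  have := chord_tail ot ou; have := min_leaves_deg_gt0 z ot; rewrite !inE /= zx gd andbT /=.
  by clear; case: (deg t z) => [|[|[|]]].
move=> /leq_trans/(_ (leq_card_setU _ _)); rewrite card_darts_deg mul1n.
have := card_chorded_darts; rewrite card_darts_deg leq_mul2l /=.
have : #|[set z | deg t z == 1]| + #|[set z | deg t z == 2]| + #|branch_vertices t| = #|V|.
  rewrite !card_set_sum -!big_split -[RHS]muln1 -sum_const /=; apply: eq_bigr => z _.
  by rewrite !inE; have := min_leaves_deg_gt0 z ot; clear; lia.
by move=> <- G2 E1; rewrite leq_add2r (leq_trans E1) ?leq_add2l.
Qed.

End Count.
End Optimal.

(** * Comparing the two bounds on the degrees of the leaves *)

Theorem theorem2p2 (V : finType) (e : rel V) (k : nat) :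
  simple_graph e -> connected e -> K14_free e ->
  sigma_ge e (k + 3) (#|V| - k) ->
  exists t : rel V, spanning_tree e t /\
    #|leaves t| + #|branch_vertices t| <= 2 * k + 3.
Proof.
move=> [es ei] ce K14 sig; have [V0|[r _]] := set_0Vmem [set: V].
  (* The graph without vertices is its own spanning tree. *)
  have V0' (A : {set V}) : #|A| = 0.
    by apply/eqP; rewrite -leqn0 -(cards0 V) -V0 subset_leq_card.
  exists e; rewrite !V0'; split => //; do 2 split => //.
  by split => // -[x]; have := in_set0 x; rewrite -V0 inE.
apply: NNPP => no.
have many_ends t : tree t -> subrel t e -> 2 * k + 3 < #|leaves t| + #|branch_vertices t|.
  move=> tt te; rewrite ltnNge; apply/negP => small; apply: no; exists t.
  by split => //; split => //; split; [case: tt|split; [case: tt|apply: acyclic]].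
(* With at most one vertex, |L| + |B| <= 2 contradicts [many_ends]; otherwise |B| <= |L| - 2 forces
   |L| >= k + 3. *)
have three t : tree t -> subrel t e -> 2 < #|leaves t|.
  move=> tt te; have LB := many_ends t tt te; have [V1|V1] := ltnP 1 #|V|.
    by move: LB (leaves_branch tt V1); clear; lia.
  have small (A : {set V}) : #|A| <= 1 := leq_trans (max_card _) V1.
  by move: LB (small (leaves t)) (small (branch_vertices t)); clear; lia.
have [s [se ts]] := spanning_subtree r es ei ce.
have [|t0 [tt0 te0] min0] := @minimizer (rel V) (fun t => tree t /\ subrel t e) (fun t => #|leaves t|).
  by exists s.
have [|t ot mint] := @minimizer (rel V) (min_leaves e) (fun t => #|branch_vertices t|).
  by exists t0; split => // s' ts' se'; apply: min0.
have o2 : min_leaves_branches e t by [].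
have sum := sum_leaf_deg es ei K14 three o2.
have [tt te _] := ot; have LB := many_ends t tt te.
have V1 := many_vertices three ot; have BL := leaves_branch tt V1.
have /card_geqP[l [ul sl lL]] : k + 3 <= #|leaves t| by move: LB BL; clear; lia.
pose S := [set x in l].
have cS : #|S| = k + 3 by rewrite cardsE (card_uniqP ul).
have SL : S \subset leaves t by apply/subsetP => x; rewrite inE; apply: lL.
have iS : independent e S.
  apply/forall_inP => x /(subsetP SL) xL; apply/forall_inP => y /(subsetP SL).
  exact: (min_leaves_indep es ei three ot xL).
have := sig S iS cS; have := cardsID S (leaves t); rewrite (setIidPr SL) cS.
move: sum; rewrite (big_setID S) /= (setIidPr SL).
have : #|leaves t :\: S| <= \sum_(u in leaves t :\: S) deg e u.
  rewrite -sum1_card; apply: leq_sum => u _.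
  exact: leq_trans (deg_gt0 tt u V1) (deg_subrel u te).
by move: LB BL; clear; lia.
Qed.
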